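(* Let $H=\{\lambda\in B_{1/\sqrt2}(0):\ \mathrm{Re}(\lambda)>0,\ \mathrm{Im}(\lambda)>0\}\setminus B_{2/3}(1/3)$. Then $$\mathcal M\cap \mathrm{int}(H)\subset \mathrm{clos}(\mathrm{int}(\mathcal M)),$$ i.e. every point of $\mathcal M$ lying in the interior of $H$ is a limit of interior points of $\mathcal M$.
   Context: $\mathbb D=\{z\in\mathbb C:|z|<1\}$; $B_r(z_0)$ denotes the open disc of radius $r$ centered at $z_0$. For $\lambda\in\mathbb D$, $A_\lambda=\{\sum_{n\ge0}a_n\lambda^n: a_n\in\{-1,1\}\}$ is the attractor of the iterated function system $\{\lambda z-1,\lambda z+1\}$ on $\mathbb C$. $\mathcal M=\{\lambda\in\mathbb D: A_\lambda \text{ is connected}\}$; equivalently $\mathcal M=\{\lambda\in\mathbb D:\ \exists (a_k)_{k\ge1},\ a_k\in\{-1,0,1\},\ 1+\sum_{k\ge1}a_k\lambda^k=0\}$. $\mathrm{int}$ and $\mathrm{clos}$ denote interior and closure in $\mathbb C$. *)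

(* Defs.v *)
From HB Require Import structures.
From mathcomp Require Import all_boot all_order all_algebra.
From mathcomp Require Import all_classical all_reals all_analysis.
From mathcomp Require Import complex.
Set Implicit Arguments. Unset Strict Implicit. Unset Printing Implicit Defensive.
Import Order.TTheory GRing.Theory Num.Theory.
Import numFieldTopology.Exports numFieldNormedType.Exports.
Local Open Scope classical_set_scope.
Local Open Scope ring_scope.
Local Open Scope complex_scope.

(* The complex plane is modelled as R[i] for an arbitrary realType R;
   its topology is the one induced by the modulus. *)

HB.instance Definition _ (R : realType) := NormedModule.copy R[i] (R[i])^o.

Definition attractor (R : realType) (l : R[i]) : set R[i] :=
  [set z | exists a : nat -> R[i], (forall n, a n = 1 \/ a n = -1) /\
      (series (fun n => a n * l ^+ n) @ \oo --> z)].

Definition Mset (R : realType) : set R[i] :=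
  [set l | `|l| < 1 /\ connected (attractor l)].

Definition Hset (R : realType) : set R[i] :=
  [set l : R[i] | `|l| < ((Num.sqrt (2 : R))^-1)%:C /\ 0 < complex.Re l /\ 0 < complex.Im l]
  `\` [set l : R[i] | `|l - ((3 : R)^-1)%:C| < ((2 : R) / 3)%:C].

Arguments Mset R : clear implicits.
Arguments Hset R : clear implicits.

(* Main.v *)
Require Import Defs.
From HB Require Import structures.
From mathcomp Require Import all_boot all_order all_algebra.
From mathcomp Require Import all_classical all_reals all_analysis.
From mathcomp Require Import complex ring lra.
Set Implicit Arguments. Unset Strict Implicit. Unset Printing Implicit Defensive.
Import Order.TTheory GRing.Theory Num.Theory.
Import numFieldTopology.Exports numFieldNormedType.Exports.
Local Open Scope classical_set_scope.
Local Open Scope ring_scope.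
Local Open Scope complex_scope.
Import Normc.

(** Separating the two first-level pieces of the attractor shows that [l] is in
    [Mset] iff [l] is a zero of a power series [f] with constant term [1] and
    coefficients in {-1, 0, 1}.  By Hurwitz's theorem, partial sums of [f] have
    zeros [z] arbitrarily close to a given zero of [f].  For [l] in [Hset], a
    parallelogram [P = {u + v l}] around [0] satisfies
    [P `<=` \bigcup_(b in {-1, 0, 1}) (b + l P)], so every point of [P] is a value
    at [l] of a power series with coefficients in {-1, 0, 1}.  Hence for [l] near
    [z] the small number [- p l / l ^+ n], with [p] the partial sum vanishing at
    [z], is such a value, and the partial sum extends to a full series vanishing
    at [l]: a whole neighbourhood of [z] lies in [Mset]. *)

(** * Real-valued modulus and the topology of the complex plane *)

Section Modulus.
Context {R : realType}.
Implicit Types (z w : R[i]) (e : R).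

Lemma normrE z : `|z| = (normc z)%:C.
Proof. by []. Qed.

Lemma normc_ge0 z : 0 <= normc z.
Proof. by case: z => a b; exact: sqrtr_ge0. Qed.

Lemma normc_eq0 z : (normc z == 0) = (z == 0).
Proof.
by apply/eqP/eqP => [/eq0_normc //|->]; exact: normc0.
Qed.

Lemma normc_gt0 z : (0 < normc z) = (z != 0).
Proof. by rewrite lt0r normc_eq0 normc_ge0 andbT. Qed.

Lemma normcX z n : normc (z ^+ n) = normc z ^+ n.
Proof.
by elim: n => [|n IH]; [rewrite !expr0 normc1|rewrite !exprS normcM IH].
Qed.

Lemma normc_distC z w : normc (z - w) = normc (w - z).
Proof. by rewrite -opprB normcN. Qed.

Lemma normc_sqr z : normc z ^+ 2 = complex.Re z ^+ 2 + complex.Im z ^+ 2.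
Proof. by case: z => a b /=; rewrite sqr_sqrtr// addr_ge0// sqr_ge0. Qed.

Lemma ler_Re_normc z : `|complex.Re z| <= normc z.
Proof.
rewrite -(ler_pXn2r (n := 2)) ?nnegrE ?normr_ge0 ?normc_ge0//.
by rewrite normc_sqr real_normK ?num_real// lerDl sqr_ge0.
Qed.

Lemma ler_Im_normc z : `|complex.Im z| <= normc z.
Proof.
rewrite -(ler_pXn2r (n := 2)) ?nnegrE ?normr_ge0 ?normc_ge0//.
by rewrite normc_sqr real_normK ?num_real// lerDr sqr_ge0.
Qed.

Lemma normc_le_ReIm z : normc z <= `|complex.Re z| + `|complex.Im z|.
Proof.
rewrite -(ler_pXn2r (n := 2)) ?nnegrE ?addr_ge0 ?normr_ge0 ?normc_ge0//.
rewrite normc_sqr sqrrD !real_normK ?num_real//.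
by rewrite addrAC lerDl mulrn_wge0// mulr_ge0.
Qed.

Lemma normc_real (x : R) : normc x%:C = `|x|.
Proof. by rewrite /= expr0n /= addr0 sqrtr_sqr. Qed.

Lemma normc_triangle z w v : normc (z - v) <= normc (z - w) + normc (w - v).
Proof. by rewrite -[z - v](subrKA w) le_normcD. Qed.

Lemma ler_normcB z w : normc z - normc w <= normc (z - w).
Proof. by rewrite lerBlDr -{1}(subrK w z) le_normcD. Qed.

Lemma nbhs_normcP z (A : set R[i]) :
  nbhs z A <-> exists2 e, 0 < e & forall w, normc (w - z) < e -> A w.
Proof.
split=> [/nbhs_ballP[e /= e0 eA]|[e e0 eA]].
  (* Positivity in [R[i]] forces a zero imaginary part, so the radius [e] equals its real part. *)
  have := e0; rewrite ltcE /= => /andP[/eqP e2 e1].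
  exists (complex.Re e) => // w wz; apply: eA => /=.
  rewrite -ball_normE /ball_ /= normrE ltcE /= e2 eqxx /=.
  by rewrite normc_distC.
apply/nbhs_ballP; exists e%:C; first by rewrite /= ltcR.
move=> w; rewrite -ball_normE /ball_ /= normrE ltcR => zw.
by apply: eA; rewrite normc_distC.
Qed.

Lemma cvg_normcP (u : nat -> R[i]) z :
  u @ \oo --> z <->
  forall e, 0 < e -> exists n0, forall n, (n0 <= n)%N -> normc (z - u n) < e.
Proof.
split=> [uz e e0|uz].
  have : nbhs z [set w | normc (w - z) < e].
    by apply/nbhs_normcP; exists e.
  move=> /uz [n0 _ n0P]; exists n0 => n n0n; rewrite normc_distC.
  exact: n0P.
move=> A /nbhs_normcP[e e0 eA]; have [n0 n0P] := uz e e0.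
by exists n0 => // n /= /n0P; rewrite normc_distC => /eA.
Qed.

Lemma geometric_small (K r e : R) : 0 <= r < 1 -> 0 < e ->
  exists n0, forall n, (n0 <= n)%N -> K * r ^+ n < e.
Proof.
move=> /andP[r0 r1] e0.
have : geometric K r @ \oo --> (0 : R) by apply: cvg_geometric; rewrite ger0_norm.
move=> /cvgrPdist_lt /(_ e e0)[n0 _ n0P]; exists n0 => n n0n.
have := n0P n n0n; rewrite /= sub0r normrN; apply: le_lt_trans.
exact: ler_norm.
Qed.

Lemma normc_le_eps z w : (forall e, 0 < e -> normc (z - w) <= e) -> z = w.
Proof.
move=> H; apply/eqP; rewrite -subr_eq0 -normc_eq0 eq_le normc_ge0 andbT.
by apply/ler_addgt0Pl => e e0; rewrite addr0 H.
Qed.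

End Modulus.

(** * Power series with bounded coefficients in the unit disc *)

Section PowerSeries.
Context {R : realType}.
Implicit Types (a : nat -> R[i]) (z w : R[i]) (K r : R).

Definition pseries a z : nat -> R[i] := series (fun n => a n * z ^+ n).

Definition psum a z : R[i] := lim (pseries a z @ \oo).

Definition shift a : nat -> R[i] := fun k => a k.+1.

Lemma pseriesS a z n : pseries a z n.+1 = pseries a z n + a n * z ^+ n.
Proof. by rewrite /pseries /series /= big_nat_recr. Qed.

Lemma pseries0 a z : pseries a z 0%N = 0.
Proof. by rewrite /pseries /series /= big_geq. Qed.

Lemma pseries_shift a z n :
  pseries a z n.+1 = a 0%N + z * pseries (shift a) z n.
Proof.
elim: n => [|n IH]; first by rewrite pseriesS !pseries0 expr0; ring.
by rewrite pseriesS IH pseriesS exprS /shift; ring.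
Qed.

Lemma normc_pseriesB a z K m n : (forall k, normc (a k) <= K) ->
  normc z < 1 -> (n <= m)%N ->
  normc (pseries a z m - pseries a z n) <= K * normc z ^+ n / (1 - normc z).
Proof.
move=> aK z1 nm.
have K0 : 0 <= K by apply: le_trans (aK 0%N); exact: normc_ge0.
have z0 := normc_ge0 z.
have d0 : 0 < 1 - normc z by rewrite subr_gt0.
(* Subtracting [normc z ^+ m] makes the bound telescope, so that induction on the number of terms
   goes through. *)
have sharp : normc (pseries a z m - pseries a z n) <=
    K * (normc z ^+ n - normc z ^+ m) / (1 - normc z).
  rewrite -(subnKC nm); elim: (m - n)%N => [|d IH].
    by rewrite addn0 !subrr normc0 mulr0 mul0r.
  rewrite addnS pseriesS.
  have -> : K * (normc z ^+ n - normc z ^+ (n + d).+1) / (1 - normc z) =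
      K * (normc z ^+ n - normc z ^+ (n + d)) / (1 - normc z)
      + K * normc z ^+ (n + d).
    by rewrite exprS; field; lra.
  rewrite addrAC; apply: le_trans (le_normcD _ _) _; apply: lerD => //.
  by rewrite normcM normcX ler_wpM2r// exprn_ge0.
apply: le_trans sharp _; rewrite ler_pM2r ?invr_gt0// ler_wpM2l//.
by rewrite gerBl exprn_ge0.
Qed.

Lemma cvg_ReIm (u : nat -> R[i]) (x y : R) :
  (fun n => complex.Re (u n)) @ \oo --> x ->
  (fun n => complex.Im (u n)) @ \oo --> y -> u @ \oo --> (x +i* y).
Proof.
move=> ux uy; apply/cvg_normcP => e e0.
have e2 : 0 < e / 2 by lra.
move: ux => /cvgrPdist_lt /(_ _ e2)[n1 _ n1P].
move: uy => /cvgrPdist_lt /(_ _ e2)[n2 _ n2P].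
exists (maxn n1 n2) => n; rewrite geq_max => /andP[/n1P /= h1 /n2P /= h2].
apply: le_lt_trans (normc_le_ReIm _) _.
by move: h1 h2; case: (u n) => p q /= h1 h2; lra.
Qed.

Lemma geometric_dominated_cvg (u : nat -> R) K r : 0 <= r < 1 ->
  (forall n, `|u n| <= K * r ^+ n) -> cvgn (series u).
Proof.
move=> /andP[r0 r1] uK; apply: normed_cvg.
apply: (@series_le_cvg _ _ (geometric K r)) => //=.
- by move=> n; apply: le_trans (uK n).
- by apply: is_cvg_geometric_series; rewrite ger0_norm.
Qed.

(** Real and imaginary parts are dominated by a geometric series, so both converge absolutely. *)
Lemma cvg_pseries a z K : (forall k, normc (a k) <= K) -> normc z < 1 ->
  pseries a z @ \oo --> psum a z.
Proof.
move=> aK z1.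
have bnd n : normc (a n * z ^+ n) <= K * normc z ^+ n.
  by rewrite normcM normcX ler_wpM2r// exprn_ge0// normc_ge0.
have z01 : 0 <= normc z < 1 by rewrite normc_ge0.
have cre : cvgn (series (fun n => complex.Re (a n * z ^+ n))).
  apply: (@geometric_dominated_cvg _ K _ z01) => n.
  exact: le_trans (ler_Re_normc _) (bnd n).
have cim : cvgn (series (fun n => complex.Im (a n * z ^+ n))).
  apply: (@geometric_dominated_cvg _ K _ z01) => n.
  exact: le_trans (ler_Im_normc _) (bnd n).
have reE : (fun n => complex.Re (pseries a z n)) =
    series (fun n => complex.Re (a n * z ^+ n)).
  apply/funext => n; elim: n => [|n IH]; first by rewrite pseries0 /series /= big_geq.
  rewrite pseriesS /series /= big_nat_recr//= -[X in _ = X + _]IH.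
  by case: (pseries _ _ _) => ? ?; case: (_ * _).
have imE : (fun n => complex.Im (pseries a z n)) =
    series (fun n => complex.Im (a n * z ^+ n)).
  apply/funext => n; elim: n => [|n IH]; first by rewrite pseries0 /series /= big_geq.
  rewrite pseriesS /series /= big_nat_recr//= -[X in _ = X + _]IH.
  by case: (pseries _ _ _) => ? ?; case: (_ * _).
have : pseries a z @ \oo -->
    (limn (series (fun n => complex.Re (a n * z ^+ n))) +i*
     limn (series (fun n => complex.Im (a n * z ^+ n)))).
  by apply: cvg_ReIm; rewrite ?reE ?imE.
by move=> /cvgP.
Qed.

Lemma cvgn_unique (u : nat -> R[i]) z w : u @ \oo --> z -> u @ \oo --> w -> z = w.
Proof.
move=> /cvg_normcP uz /cvg_normcP uw; apply: normc_le_eps => e e0.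
have e2 : 0 < e / 2 by lra.
have [n1 n1P] := uz _ e2; have [n2 n2P] := uw _ e2.
have := n1P _ (leq_maxl n1 n2); have := n2P _ (leq_maxr n1 n2).
rewrite (normc_distC w).
by have := normc_triangle z (u (maxn n1 n2)) w; lra.
Qed.

Lemma psum_unique a z w : pseries a z @ \oo --> w -> psum a z = w.
Proof. by move=> c; have := cvgP _ c => /cvgn_unique; apply. Qed.

Opaque psum.

Lemma normc_psumB a z K n : (forall k, normc (a k) <= K) -> normc z < 1 ->
  normc (psum a z - pseries a z n) <= K * normc z ^+ n / (1 - normc z).
Proof.
move=> aK z1; apply/ler_addgt0Pl => e e0.
have /cvg_normcP /(_ e e0)[n0 n0P] := cvg_pseries aK z1.
have := n0P _ (leq_maxl n0 n).
have := normc_pseriesB aK z1 (leq_maxr n0 n).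
by have := normc_triangle (psum a z) (pseries a z (maxn n0 n)) (pseries a z n); lra.
Qed.

Lemma normc_psum a z K : (forall k, normc (a k) <= K) -> normc z < 1 ->
  normc (psum a z) <= K / (1 - normc z).
Proof.
move=> aK z1; have := normc_psumB 0 aK z1.
by rewrite pseries0 subr0 expr0 mulr1.
Qed.

(** A geometric error bound yields convergence and the value together; sums of quotients,
    half-differences and digit expansions are identified this way. *)
Lemma psum_geometric a z w K : normc z < 1 ->
  (forall n, normc (w - pseries a z n) <= K * normc z ^+ n) -> psum a z = w.
Proof.
move=> z1 wK; apply: psum_unique; apply/cvg_normcP => e e0.
have z01 : 0 <= normc z < 1 by rewrite normc_ge0.
have [n0 n0P] := geometric_small K z01 e0.
by exists n0 => n /n0P; apply: le_lt_trans.
Qed.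

Lemma psum_shift a z K : (forall k, normc (a k) <= K) -> normc z < 1 ->
  psum a z = a 0%N + z * psum (shift a) z.
Proof.
move=> aK z1; apply: psum_unique; apply/cvg_normcP => e e0.
have sK k : normc (shift a k) <= K by exact: aK.
have /cvg_normcP /(_ e e0)[n0 n0P] := cvg_pseries sK z1.
exists n0.+1 => -[//|n] n0n; rewrite pseries_shift opprD addrACA subrr add0r.
rewrite -mulrBr normcM; apply: le_lt_trans (n0P n n0n).
by rewrite ler_piMl ?normc_ge0 ?ltW.
Qed.

(** * Division by [z - w] and the order of a zero *)

Definition shiftn n a : nat -> R[i] := fun k => a (n + k)%N.

Lemma psum_shiftn a z K n : (forall k, normc (a k) <= K) -> normc z < 1 ->
  psum (shiftn n a) z = a n + z * psum (shiftn n.+1 a) z.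
Proof.
move=> aK z1; rewrite (@psum_shift _ _ K)//; last by move=> k; exact: aK.
rewrite /shiftn addn0; congr (_ + _ * psum _ _); apply/funext => k.
by rewrite /shift addnS addSn.
Qed.

(* Coefficients of the quotient of [psum a z - psum a w] by [z - w]. *)
Definition quot w a : nat -> R[i] := fun k => psum (shiftn k.+1 a) w.

Lemma normc_quot a w K : (forall k, normc (a k) <= K) -> normc w < 1 ->
  forall k, normc (quot w a k) <= K / (1 - normc w).
Proof. by move=> aK w1 k; apply: normc_psum => // j; exact: aK. Qed.

(** Unrolling [psum_shiftn] at [z] and at [w] gives the identity for partial sums of the quotient,
    with remainder [z ^+ n] times a bounded difference of tails. *)
Lemma psum_quot a z w K : (forall k, normc (a k) <= K) ->
  normc z < 1 -> normc w < 1 ->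
  psum a z = psum a w + (z - w) * psum (quot w a) z.
Proof.
move=> aK z1 w1.
have [->|zw] := eqVneq z w; first by rewrite subrr mul0r addr0.
have zw0 : z - w != 0 by rewrite subr_eq0.
have rec n : psum a z - psum a w = (z - w) * pseries (quot w a) z n
    + z ^+ n * (psum (shiftn n a) z - psum (shiftn n a) w).
  elim: n => [|n ->]; first by rewrite pseries0 expr0 mulr0 add0r mul1r.
  rewrite pseriesS (psum_shiftn _ aK z1) (psum_shiftn _ aK w1) exprS /quot.
  by ring.
have -> : psum (quot w a) z = (psum a z - psum a w) / (z - w).
  have z0 := normc_ge0 z; have w0 := normc_ge0 w.
  apply: (@psum_geometric _ _ _
    ((K / (1 - normc z) + K / (1 - normc w)) / normc (z - w))) => // n.
  have -> : (psum a z - psum a w) / (z - w) - pseries (quot w a) z n =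
      z ^+ n * ((psum (shiftn n a) z - psum (shiftn n a) w) / (z - w)).
    by rewrite (rec n); field.
  rewrite normcM normcX mulrC ler_wpM2r ?exprn_ge0// normcM normcV.
  rewrite ler_wpM2r ?invr_ge0 ?normc_ge0//.
  apply: le_trans (le_normcD _ _) _; rewrite normcN.
  by apply: lerD; apply: normc_psum => // k; exact: aK.
by field.
Qed.

Lemma psum_lipschitz a z w K : (forall k, normc (a k) <= K) ->
  normc z < 1 -> normc w < 1 ->
  normc (psum a z - psum a w) <=
    normc (z - w) * (K / (1 - normc w) / (1 - normc z)).
Proof.
move=> aK z1 w1; rewrite (psum_quot aK z1 w1) addrC addKr normcM.
rewrite ler_wpM2l ?normc_ge0//; apply: normc_psum => //.
exact: normc_quot.
Qed.

Lemma normc_iter_quot a w K m : (forall k, normc (a k) <= K) -> normc w < 1 ->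
  forall k, normc (iter m (quot w) a k) <= K / (1 - normc w) ^+ m.
Proof.
move=> aK w1; elim: m => [|m IH] k; first by rewrite expr0 divr1.
by rewrite exprSr invfM mulrA /=; apply: normc_quot.
Qed.

Lemma psum_iter_quot a z w K m : (forall k, normc (a k) <= K) ->
  normc z < 1 -> normc w < 1 ->
  (forall j, (j < m)%N -> psum (iter j (quot w) a) w = 0) ->
  psum a z = (z - w) ^+ m * psum (iter m (quot w) a) z.
Proof.
move=> aK z1 w1; elim: m => [|m IH] h; first by rewrite expr0 mul1r.
rewrite IH; last by move=> j jm; apply: h; exact: leqW.
rewrite (psum_quot (normc_iter_quot m aK w1) z1 w1) h// add0r /=.
by rewrite exprS; ring.
Qed.

(** Dividing [m] times multiplies the coefficient bound by (1 - |w|)^(-m) and produces the factor (z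
    - w)^m. Hence |psum a z| is at most a constant times (|z - w| / (1 - |w|))^m, for every [m]. *)
Lemma infinite_order_vanish a z w K : (forall k, normc (a k) <= K) ->
  normc z < 1 -> normc w < 1 ->
  (forall j, psum (iter j (quot w) a) w = 0) ->
  normc (z - w) < 1 - normc w -> psum a z = 0.
Proof.
move=> aK z1 w1 h zw; apply: normc_le_eps => e e0; rewrite subr0.
have d0 : 0 < 1 - normc w by lra.
have q01 : 0 <= normc (z - w) / (1 - normc w) < 1.
  by rewrite divr_ge0 ?normc_ge0 ?ltW//= ltr_pdivrMr ?mul1r.
have [m mP] := geometric_small (K / (1 - normc z)) q01 e0.
rewrite (@psum_iter_quot _ _ w K m)//.
rewrite normcM normcX; apply: le_trans (ltW (mP m (leqnn m))).
have := normc_psum (normc_iter_quot m aK w1) z1.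
move=> /(ler_wpM2l (exprn_ge0 m (normc_ge0 (z - w)))).
move=> /le_trans; apply; rewrite expr_div_n le_eqVlt; apply/orP; left.
by apply/eqP; field; rewrite expf_neq0 ?gt_eqF// subr_gt0.
Qed.

(** Strong induction on the order: once the lower orders vanish, psum a z = (z - w)^m psum b z, so
    [psum b] vanishes at nearby points other than [w], and at [w] itself by Lipschitz continuity. *)
Lemma locally_vanish_infinite_order a w K d : (forall k, normc (a k) <= K) ->
  normc w < 1 -> 0 < d ->
  (forall z, normc z < 1 -> normc (z - w) < d -> psum a z = 0) ->
  forall j, psum (iter j (quot w) a) w = 0.
Proof.
move=> aK w1 d0 h m; elim/ltn_ind: m => m IH.
set b := iter m (quot w) a.
have [L bL] : exists L, forall k, normc (b k) <= L.
  by eexists; exact: normc_iter_quot m aK w1.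
have L0 : 0 <= L by apply: le_trans (bL 0%N); exact: normc_ge0.
have w0 := normc_ge0 w.
set C := L / (1 - normc w) / ((1 - normc w) / 2).
have C0 : 0 <= C by rewrite !divr_ge0//; lra.
apply: normc_le_eps => e e0; rewrite subr0.
(* The point [w + t] stays in the disc where [psum a] vanishes and away from the unit circle; [C]
   bounds the Lipschitz constant of [psum b] between the two points, and [t * C <= e]. *)
pose t := Num.min (Num.min (d / 2) ((1 - normc w) / 2)) (e / (C + 1)).
have t0 : 0 < t.
  have C1 : 0 < C + 1 by lra.
  by rewrite !lt_min (divr_gt0 e0 C1) andbT; apply/andP; split; lra.
have td : t <= d / 2 by rewrite /t !ge_min lexx.
have tw : t <= (1 - normc w) / 2 by rewrite /t !ge_min lexx orbT.
have te : t <= e / (C + 1) by rewrite /t !ge_min lexx !orbT.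
pose z := w + t%:C.
have zwE : z - w = t%:C by rewrite /z addrC addKr.
have zw : normc (z - w) = t by rewrite zwE normc_real gtr0_norm.
have z1 : normc z <= (1 + normc w) / 2.
  by apply: le_trans (le_normcD _ _) _; rewrite normc_real gtr0_norm//; lra.
have bz : psum b z = 0.
  have : psum a z = 0 by apply: h; lra.
  rewrite (@psum_iter_quot _ _ w K m)//; last lra.
  move/eqP; rewrite mulf_eq0 expf_eq0 zwE => /orP[|/eqP//].
  by rewrite -normc_eq0 normc_real gtr0_norm// (gt_eqF t0) andbF.
have z1' : normc z < 1 by lra.
have := psum_lipschitz bL w1 z1'; rewrite bz subr0 normc_distC zw.
move=> /le_trans; apply.
have h1 : L / (1 - normc z) / (1 - normc w) <= C.
  rewrite /C mulrAC ler_wpM2l ?divr_ge0//; try lra.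
  by rewrite lef_pV2 ?posrE; lra.
apply: le_trans (ler_wpM2l (ltW t0) h1) _.
apply: le_trans (ler_wpM2r C0 te) _.
by rewrite mulrAC ler_pdivrMr; nra.
Qed.

Lemma psum0 a : psum a 0 = a 0%N.
Proof.
apply: (@psum_geometric _ _ _ (normc (a 0%N))) => [|[|n]].
- by rewrite normc0.
- by rewrite pseries0 subr0 expr0 mulr1.
- by rewrite pseries_shift mul0r addr0 subrr normc0 expr0n mulr0.
Qed.

(* Vanishing to infinite order propagates from [w] to the whole disc of radius
   [1 - |w|]; shrinking [w] towards [0] reaches the constant term. *)
Lemma infinite_order_coef0 a w K : (forall k, normc (a k) <= K) ->
  normc w < 1 -> (forall j, psum (iter j (quot w) a) w = 0) -> a 0%N = 0.
Proof.
move=> aK w1 winf.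
have [rho [rho1 wrho]] : exists rho, rho < 1 /\ normc w <= rho.
  by exists (normc w).
(* The ratio depends on [rho] only, so it serves at every stage of the induction. For |w| <= rho the
   move from [w] to [c w] has length at most (1 - |w|) / 2, and once |w| < 1/2 the disc of radius 1
   - |w| contains 0. *)
pose c := (1 + rho) / 2.
have rho0 : 0 <= rho by apply: le_trans wrho; exact: normc_ge0.
have c01 : 0 <= c < 1 by rewrite /c; lra.
have h2 : (0 : R) < 1 / 2 by lra.
have [n nP] := geometric_small rho c01 h2.
have {nP} : normc w * c ^+ n < 1 / 2.
  apply: le_lt_trans (nP n (leqnn n)); rewrite ler_wpM2r// exprn_ge0//.
  by case/andP: c01.
elim: n w w1 wrho winf => [|n IH] w w1 wrho winf wn.
  rewrite -psum0; apply: (infinite_order_vanish aK _ w1 winf).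
    by rewrite normc0.
  by rewrite sub0r normcN; move: wn; rewrite expr0 mulr1; lra.
have w0 := normc_ge0 w.
have cwN : normc (c%:C * w) = c * normc w.
  by rewrite normcM normc_real ger0_norm//; case/andP: c01.
have cw : normc (c%:C * w) <= normc w by rewrite cwN ler_piMl//; lra.
apply: (IH (c%:C * w)).
- exact: le_lt_trans cw w1.
- exact: le_trans cw wrho.
- have dE : normc (c%:C * w - w) = (1 - c) * normc w.
    have -> : c%:C * w - w = - ((1 - c)%:C * w).
      by rewrite rmorphB rmorph1 mulrBl mul1r opprB.
    by rewrite normcN normcM normc_real ger0_norm//; lra.
  have dlt : 0 < 1 - normc w - (1 - c) * normc w.
    have : (1 - c) * normc w <= (1 - normc w) / 2 * 1.
      by apply: ler_pM; rewrite /c; lra.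
    by lra.
  apply: (locally_vanish_infinite_order aK _ dlt).
    exact: le_lt_trans cw w1.
  move=> z z1 zd; apply: (infinite_order_vanish aK z1 w1 winf).
  by have := normc_triangle z (c%:C * w) w; rewrite dE; lra.
- by move: wn; rewrite cwN exprS mulrA [normc w * c]mulrC.
Qed.

Lemma finite_order a w K : (forall k, normc (a k) <= K) -> normc w < 1 ->
  a 0%N != 0 -> exists m, psum (iter m (quot w) a) w != 0 /\
    forall j, (j < m)%N -> psum (iter j (quot w) a) w = 0.
Proof.
move=> aK w1 a0; have ex : exists m, psum (iter m (quot w) a) w != 0.
  apply: contrapT => h; move/eqP: a0; apply.
  apply: (infinite_order_coef0 aK w1) => j; apply/eqP; apply: contrapT => hj.
  by apply: h; exists j; apply/negP.
case: (ex_minnP ex) => m mP minm; exists m; split=> // j jm; apply/eqP.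
by apply: contraTT jm => /minm; rewrite -leqNgt.
Qed.

(** Here [m] is the order of vanishing at [w]: after factoring out (z - w)^m, the cofactor keeps at
    least half of its modulus at [w] on a small disc, by Lipschitz continuity. *)
Lemma isolated_zero a w K : (forall k, normc (a k) <= K) -> normc w < 1 ->
  a 0%N != 0 ->
  exists m c d, [/\ 0 < c, 0 < d & forall z, normc (z - w) <= d ->
    normc z < 1 /\ c * normc (z - w) ^+ m <= normc (psum a z)].
Proof.
move=> aK w1 a0; have [m [mP mlt]] := finite_order aK w1 a0.
set b := iter m (quot w) a in mP.
have [L bL] : exists L, forall k, normc (b k) <= L.
  by eexists; exact: normc_iter_quot m aK w1.
have L0 : 0 <= L by apply: le_trans (bL 0%N); exact: normc_ge0.
have w0 := normc_ge0 w.
have v0 : 0 < normc (psum b w) by rewrite normc_gt0.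
set v := normc (psum b w) in v0.
pose C := L / (1 - normc w) / ((1 - normc w) / 2).
have C0 : 0 <= C by rewrite !divr_ge0//; lra.
pose d := Num.min ((1 - normc w) / 2) (v / 2 / (C + 1)).
have d0 : 0 < d.
  have v2 : 0 < v / 2 by lra.
  have C1 : 0 < C + 1 by lra.
  by rewrite lt_min (divr_gt0 v2 C1) andbT; lra.
have dw : d <= (1 - normc w) / 2 by rewrite /d !ge_min lexx.
have dv : d <= v / 2 / (C + 1) by rewrite /d !ge_min lexx orbT.
exists m, (v / 2), d; split=> //; first lra.
move=> z zd.
have z1 : normc z <= (1 + normc w) / 2.
  by have := ler_normcB z w; lra.
have z1' : normc z < 1 by lra.
split=> //; rewrite (@psum_iter_quot _ _ w K m)// normcM normcX mulrC.
rewrite ler_wpM2l ?exprn_ge0 ?normc_ge0//.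
have := psum_lipschitz bL w1 z1'; rewrite normc_distC (normc_distC w) -/b => h.
have h1 : L / (1 - normc z) / (1 - normc w) <= C.
  rewrite /C mulrAC ler_wpM2l ?divr_ge0//; try lra.
  by rewrite lef_pV2 ?posrE; lra.
have h2 : normc (z - w) * (L / (1 - normc z) / (1 - normc w)) <= v / 2.
  apply: le_trans (ler_wpM2l (normc_ge0 _) h1) _.
  apply: le_trans (ler_wpM2r C0 zd) _.
  apply: le_trans (ler_wpM2r C0 dv) _.
  by rewrite mulrAC ler_pdivrMr; nra.
have := ler_normcB (psum b w) (psum b z); rewrite (normc_distC (psum b w)) -/v.
by lra.
Qed.

End PowerSeries.

(** * Zeros of polynomials near a point, and of partial sums *)

Section Polynomials.
Context {R : realType}.
Implicit Types (p q : {poly R[i]}) (z w : R[i]).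

Lemma normc_horner_bound q (B : R) :
  exists C, 0 <= C /\ forall z, normc z <= B -> normc q.[z] <= C.
Proof.
elim/poly_ind: q => [|q c [C [C0 CP]]].
  by exists 0; split=> // z _; rewrite horner0 normc0.
exists (C * `|B| + normc c); split; first by rewrite addr_ge0 ?mulr_ge0 ?normc_ge0.
move=> z zB; rewrite hornerMXaddC; apply: le_trans (le_normcD _ _) _.
rewrite lerD2r normcM; apply: ler_pM; rewrite ?normc_ge0 ?CP//.
exact: le_trans zB (ler_norm _).
Qed.

Lemma horner_continuous p z (e : R) : 0 < e ->
  exists2 d, 0 < d & forall z', normc (z' - z) < d -> normc (p.[z'] - p.[z]) < e.
Proof.
move=> e0; have /factor_theorem[q qE] : root (p - p.[z]%:P) z.
  by rewrite /root !hornerE subrr.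
have [C [C0 CP]] := normc_horner_bound q (normc z + 1).
have C1 : 0 < C + 1 by lra.
exists (Num.min 1 (e / (C + 1))); first by rewrite lt_min ltr01 divr_gt0.
move=> z'; rewrite lt_min => /andP[z1 ze].
have -> : p.[z'] - p.[z] = q.[z'] * (z' - z).
  by move: (congr1 (fun r => r.[z']) qE); rewrite !hornerE.
rewrite normcM.
have qC : normc q.[z'] <= C by apply: CP; have := ler_normcB z' z; lra.
apply: le_lt_trans (ler_wpM2r (normc_ge0 _) qC) _.
move: ze; rewrite ltr_pdivlMr// => ze; apply: le_lt_trans ze.
by rewrite mulrC ler_wpM2l ?normc_ge0//; lra.
Qed.

(* d'Alembert's descent step *)
Lemma normc_horner_descent p z (e : R) : (1 < size p)%N -> p.[z] != 0 -> 0 < e ->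
  exists2 z', normc (z' - z) < e & normc p.[z'] < normc p.[z].
Proof.
move=> sp pz e0; have pc0 : p - p.[z]%:P != 0.
  rewrite subr_eq0; apply: contraTN sp => /eqP pE.
  by rewrite -leqNgt pE size_polyC leq_b1.
have [k [q qz qE]] := multiplicity_XsubC (p - p.[z]%:P) z.
move: qz; rewrite pc0 /root /= => qz.
have pE x : p.[x] = p.[z] + q.[x] * (x - z) ^+ k.
  by move: (congr1 (fun r => r.[x]) qE); rewrite !hornerE /= => <-; ring.
have k0 : (0 < k)%N.
  rewrite lt0n; apply: contraNneq qz => k0.
  by have := pE z; rewrite k0 expr0 mulr1 -{1}[p.[z]]addr0 => /addrI <-.
(* In this direction the leading increment q(z) (t w)^k equals - t^k p(z), pointing from p(z)
   towards 0. *)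
have [w wk] : exists w : R[i], w ^+ k = - p.[z] / q.[z].
  by exists (k.-root (- p.[z] / q.[z])); rewrite rootCK.
have qz0 : 0 < normc q.[z] by rewrite normc_gt0.
have [d d0 dP] := horner_continuous q z qz0.
have w1 : 0 < normc w + 1 by have := normc_ge0 w; lra.
pose t := Num.min 1 (Num.min (d / (normc w + 1)) (e / (normc w + 1))).
have t0 : 0 < t by rewrite !lt_min ltr01 !divr_gt0.
have t1 : t <= 1 by rewrite /t ge_min lexx.
have td : t <= d / (normc w + 1) by rewrite /t !ge_min lexx !orbT.
have te : t <= e / (normc w + 1) by rewrite /t !ge_min lexx !orbT.
have twlt x : t <= x / (normc w + 1) -> normc (t%:C * w) < x.
  rewrite ler_pdivlMr// => h; rewrite normcM normc_real gtr0_norm//.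
  by lra.
exists (z + t%:C * w); first by rewrite addrC addKr; exact: twlt.
rewrite pE (addrC z) addrK exprMn wk.
set y := t%:C * w + z.
have yq : normc (q.[y] - q.[z]) < normc q.[z].
  by apply: dP; rewrite addrK; exact: twlt.
have tk : 0 < t ^+ k by exact: exprn_gt0.
have tk1 : t ^+ k <= 1 by apply: exprn_ile1 => //; exact: ltW.
(* The first term has modulus (1 - t^k) |p(z)|; the second is strictly below t^k |p(z)| because
   |q(y) - q(z)| < |q(z)|. *)
have -> : p.[z] + q.[y] * (t%:C ^+ k * (- p.[z] / q.[z])) =
    (1 - t ^+ k)%:C * p.[z] - (t ^+ k)%:C * (p.[z] / q.[z] * (q.[y] - q.[z])).
  have -> : (t ^+ k)%:C = t%:C ^+ k by rewrite rmorphXn.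
  rewrite rmorphB rmorph1 rmorphXn.
  move: (t%:C ^+ k) p.[z] q.[y] q.[z] qz => T P Q Q0 Q0n.
  by field.
apply: le_lt_trans (le_normcD _ _) _.
rewrite normcN !normcM normcV !normc_real (ger0_norm (ltW tk)).
rewrite [X in X * _ + _ < _]ger0_norm; last lra.
have pz0 : 0 < normc p.[z] by rewrite normc_gt0.
have : normc p.[z] / normc q.[z] * normc (q.[y] - q.[z]) < normc p.[z].
  by rewrite mulrAC ltr_pdivrMr// ltr_pM2l.
by move=> h; have := ltr_pM2l tk (normc p.[z] / normc q.[z] * normc (q.[y] - q.[z]))
  (normc p.[z]); rewrite h => {}h; lra.
Qed.

(** The modulus attains a minimum on the closed square of half-side [s] around [w], which lies in
    the disc of radius 2s. The minimum is at most |p(w)| < c, so it is attained at distance less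
    than [s] from [w], with room for a descent step inside the square; the value must then be 0. *)
Lemma minimum_modulus p w (s c : R) : 0 < s -> normc p.[w] < c ->
  (forall z, s <= normc (z - w) <= 2 * s -> c <= normc p.[z]) ->
  exists2 z, normc (z - w) <= 2 * s & p.[z] = 0.
Proof.
move=> s0 pwc hc.
pose A := `[complex.Re w - s, complex.Re w + s] `*`
  `[complex.Im w - s, complex.Im w + s].
pose f (x : R * R) := normc p.[x.1 +i* x.2].
have AP (x : R * R) : A x <->
    `|x.1 - complex.Re w| <= s /\ `|x.2 - complex.Im w| <= s.
  by rewrite /A /= !in_itv /= !ler_distl.
have A0 : A (complex.Re w, complex.Im w).
  by apply/AP; rewrite !subrr normr0 ltW.
have cA : compact A by apply: compact_setX; exact: segment_compact.
have cf : {within A, continuous f}.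
  apply: continuous_subspaceT => -[x1 x2]; apply/cvgrPdist_lt => e e0.
  have [d d0 dP] := horner_continuous p (x1 +i* x2) e0.
  have d2 : 0 < d / 2 by lra.
  exists (ball x1 (d / 2), ball x2 (d / 2)).
    by split; apply: nbhsx_ballx.
  move=> [y1 y2] [/=]; rewrite /ball /= => h1 h2.
  have dlt : normc ((y1 +i* y2) - (x1 +i* x2)) < d.
    apply: le_lt_trans (normc_le_ReIm _) _ => /=.
    by rewrite (distrC y1) (distrC y2); lra.
  have := dP _ dlt; rewrite /f /=.
  have := ler_normcB p.[x1 +i* x2] p.[y1 +i* y2].
  have := ler_normcB p.[y1 +i* y2] p.[x1 +i* x2].
  rewrite (normc_distC p.[x1 +i* x2]) => u1 u2 u3.
  by rewrite ltr_norml; apply/andP; split; lra.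
have [[x1 x2] /set_mem xA xmin] := @compact_EVT_min _ _ f A (ex_intro _ _ A0) cA cf.
pose z := x1 +i* x2.
have zmin y : `|complex.Re y - complex.Re w| <= s ->
    `|complex.Im y - complex.Im w| <= s -> normc p.[z] <= normc p.[y].
  case: y => y1 y2 h1 h2.
  by apply: (xmin (y1, y2)); apply/mem_set/AP.
have [/= xA1 xA2] := (AP (x1, x2)).1 xA.
have ReB (u v : R[i]) : complex.Re (u - v) = complex.Re u - complex.Re v.
  by case: u v => ? ? [].
have ImB (u v : R[i]) : complex.Im (u - v) = complex.Im u - complex.Im v.
  by case: u v => ? ? [].
have zw : normc (z - w) <= 2 * s.
  by have := normc_le_ReIm (z - w); rewrite ReB ImB /=; lra.
exists z => //; apply/eqP; apply: contrapT => /negP pz.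
have pzw : normc p.[z] <= normc p.[w].
  by apply: zmin; rewrite subrr normr0 ltW.
have zs : normc (z - w) < s.
  by rewrite ltNge; apply/negP => h; have := hc z; rewrite h zw => /(_ isT); lra.
have sp : (1 < size p)%N.
  rewrite ltnNge; apply/negP => /size1_polyC pE.
  have := hc (w + s%:C); rewrite addrC addKr normc_real gtr0_norm// lexx /=.
  move: pwc; rewrite pE !hornerC => h1 /(_ _)/le_lt_trans h2.
  by have := h2 _ _ h1; rewrite ltxx => /(_ _)/negP; apply => //; lra.
have ds : 0 < s - normc (z - w) by lra.
have [y yz py] := normc_horner_descent sp pz ds.
have yw : normc (y - w) <= s by have := normc_triangle y z w; lra.
have : normc p.[z] <= normc p.[y].
  apply: zmin.
    by rewrite -ReB; exact: le_trans (ler_Re_normc _) yw.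
  by rewrite -ImB; exact: le_trans (ler_Im_normc _) yw.
by lra.
Qed.

Definition trunc (a : nat -> R[i]) n : {poly R[i]} := \poly_(k < n) a k.

Lemma horner_trunc a n z : (trunc a n).[z] = pseries a z n.
Proof. by rewrite horner_poly /pseries /series /= big_mkord. Qed.

(* Hurwitz's theorem for the partial sums of a power series *)
Lemma trunc_zero a w (K e : R) : (forall k, normc (a k) <= K) ->
  normc w < 1 -> a 0%N != 0 -> psum a w = 0 -> 0 < e ->
  exists n z, [/\ (0 < n)%N, normc (z - w) < e & (trunc a n).[z] = 0].
Proof.
move=> aK w1 a0 aw e0.
have [m [c [d [c0 d0 cd]]]] := isolated_zero aK w1 a0.
have w0 := normc_ge0 w.
pose s := Num.min (Num.min (d / 2) (e / 3)) ((1 - normc w) / 4).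
have s0 : 0 < s by rewrite !lt_min; apply/andP; split; [apply/andP; split|]; lra.
have sd : s <= d / 2 by rewrite /s !ge_min lexx.
have se : s <= e / 3 by rewrite /s !ge_min lexx orbT.
have sw : s <= (1 - normc w) / 4 by rewrite /s !ge_min lexx !orbT.
pose r := (1 + normc w) / 2.
have r01 : 0 <= r < 1 by rewrite /r; lra.
(* On the annulus s <= |z - w| <= 2s the sum has modulus at least [g]. A partial sum within g/2 of
   it has modulus at least g/2 there, but less than g/2 at [w]. *)
pose g := c * s ^+ m.
have g0 : 0 < g by rewrite mulr_gt0// exprn_gt0.
have g2 : 0 < g / 2 by lra.
(* The successor ensures [0 < n], so that the truncation retains the constant term. *)
have [n0 n0P] := geometric_small (K / (1 - r)) r01 g2; pose n := n0.+1.
have K0 : 0 <= K by apply: le_trans (aK 0%N); exact: normc_ge0.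
have close z : normc (z - w) <= 2 * s ->
    normc (psum a z - (trunc a n).[z]) < g / 2.
  move=> zw; have zr : normc z <= r by have := ler_normcB z w; rewrite /r; lra.
  rewrite horner_trunc; have z1 : normc z < 1 by lra.
  apply: le_lt_trans (normc_psumB n aK z1) _.
  apply: le_lt_trans (n0P n (leqnSn n0)); rewrite mulrAC.
  have z0 := normc_ge0 z.
  apply: ler_pM; rewrite ?exprn_ge0 ?divr_ge0//; try lra.
    by rewrite ler_wpM2l// lef_pV2 ?posrE; lra.
  by rewrite lerXn2r ?nnegrE//; lra.
have pw : normc (trunc a n).[w] < g / 2.
  have := close w; rewrite aw sub0r normcN subrr normc0; apply; lra.
have [z zw z0] : exists2 z, normc (z - w) <= 2 * s & (trunc a n).[z] = 0.
  apply: (minimum_modulus s0 pw) => z /andP[zs z2].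
  have [|z1 zc] := cd z; first lra.
  have : g <= c * normc (z - w) ^+ m.
    by rewrite ler_pM2l// lerXn2r ?nnegrE ?normc_ge0// ltW.
  have := close z z2.
  have := ler_normcB (psum a z) (trunc a n).[z]; lra.
by exists n, z; split=> //; lra.
Qed.

End Polynomials.

(** * The attractor as an image of Cantor space *)

Section Attractor.
Context {R : realType}.
Implicit Types (l z : R[i]) (a : nat -> R[i]).

Definition signs a := forall n, a n = 1 \/ a n = -1.

Definition sgn (b : bool) : R[i] := if b then 1 else -1.

Lemma signs_sgn (c : nat -> bool) : signs (fun n => sgn (c n)).
Proof. by move=> n; rewrite /sgn; case: (c n); [left|right]. Qed.

Lemma normc_signs a : signs a -> forall n, normc (a n) <= 1.
Proof. by move=> h n; case: (h n) => ->; rewrite ?normcN normc1. Qed.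

Lemma signsE a : signs a -> exists c : nat -> bool, a = fun n => sgn (c n).
Proof.
move=> h; exists (fun n => a n == 1); apply/funext => n; rewrite /sgn.
by case: eqP => // h1; case: (h n).
Qed.

Lemma attractorP l z : normc l < 1 ->
  attractor l z <-> exists c : nat -> bool, z = psum (fun n => sgn (c n)) l.
Proof.
move=> l1; split=> [[a [sa az]]|[c ->]].
  have [c aE] := signsE sa; exists c; rewrite -aE.
  by symmetry; exact: psum_unique az.
exists (fun n => sgn (c n)); split; first exact: signs_sgn.
exact: cvg_pseries (normc_signs (signs_sgn c)) l1.
Qed.

Lemma attractor_step l (b : bool) z : normc l < 1 -> attractor l z ->
  attractor l (sgn b + l * z).
Proof.
move=> l1 /(attractorP _ l1)[c ->]; apply/(attractorP _ l1).
exists (fun n => if n is k.+1 then c k else b).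
by rewrite [RHS](psum_shift (normc_signs (signs_sgn _)) l1).
Qed.

Lemma attractor_split l z : normc l < 1 -> attractor l z ->
  exists b, exists2 z', attractor l z' & z = sgn b + l * z'.
Proof.
move=> l1 /(attractorP _ l1)[c ->].
exists (c 0%N), (psum (fun n => sgn (c n.+1)) l).
  by apply/(attractorP _ l1); exists (fun n => c n.+1).
by rewrite (psum_shift (normc_signs (signs_sgn _)) l1).
Qed.

Lemma normc_attractor l z : normc l < 1 -> attractor l z ->
  normc z <= (1 - normc l)^-1.
Proof.
move=> l1 /(attractorP _ l1)[c ->].
by have := normc_psum (normc_signs (signs_sgn c)) l1; rewrite mul1r.
Qed.

Lemma attractor_prefix l (c : nat -> bool) n z : normc l < 1 -> attractor l z ->
  attractor l (pseries (fun k => sgn (c k)) l n + l ^+ n * z).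
Proof.
move=> l1; elim: n z => [|n IH] z Az; first by rewrite pseries0 add0r expr0 mul1r.
have := IH _ (attractor_step (c n) l1 Az).
by congr (attractor _ _); rewrite pseriesS exprSr; ring.
Qed.

Lemma cantor_agree_nbhs (c : cantor_space) n :
  nbhs c [set c' : cantor_space | forall k, (k < n)%N -> c' k = c k].
Proof.
elim: n => [|n IH]; first by apply: filterE => c' k.
have hn : nbhs c [set c' : cantor_space | c' n = c n].
  have : open_nbhs (c n) [set c n] by split; first exact: discrete_open.
  move=> /open_nbhs_nbhs; exact: (@proj_continuous nat (fun=> bool) n c).
apply: filterS (filterI IH hn) => c' [h1 h2] k.
by rewrite ltnS leq_eqVlt => /orP[/eqP ->//|/h1].
Qed.

(** The hypothesis is continuity for the product topology, spelled out on cylinders; a compact image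
    in a Hausdorff space is closed. *)
Lemma closed_cantor_image (f : cantor_space -> R[i]) :
  (forall c (e : R), 0 < e -> exists n, forall c' : cantor_space,
     (forall k, (k < n)%N -> c' k = c k) -> normc (f c' - f c) < e) ->
  closed (range f).
Proof.
move=> fc; apply: compact_closed.
  by apply: norm_hausdorff.
apply: continuous_compact; last exact: cantor_space_compact.
apply: continuous_subspaceT => c A /nbhs_normcP[e e0 eA].
have [n nP] := fc c e e0.
by apply: filterS (cantor_agree_nbhs c n) => c' /nP /eA.
Qed.

(** Sums whose first [n] signs agree differ by at most 2 |l|^n / (1 - |l|), which gives continuity
    in the sign sequence. *)
Lemma closed_piece l (b : bool) : normc l < 1 ->
  closed [set sgn b + l * z | z in attractor l].
Proof.
move=> l1.
have -> : [set sgn b + l * z | z in attractor l] =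
    range (fun c : cantor_space => sgn b + l * psum (fun n => sgn (c n)) l).
  apply/seteqP; split=> y [z]; last first.
    move=> _ <-; exists (psum (fun n => sgn (z n)) l) => //.
    by apply/(attractorP _ l1); exists z.
  by move=> /(attractorP _ l1)[c ->] <-; exists c.
apply: closed_cantor_image => c e e0.
have l01 : 0 <= normc l < 1 by rewrite normc_ge0.
have [n nP] := geometric_small (2 / (1 - normc l)) l01 e0.
exists n => c' cc'; rewrite opprD addrACA subrr add0r -mulrBr normcM.
set u := psum _ l; set v := psum _ l.
have h1 : normc (u - pseries (fun k => sgn (c' k)) l n) <= _ :=
  normc_psumB n (normc_signs (signs_sgn c')) l1.
have h2 : normc (v - pseries (fun k => sgn (c k)) l n) <= _ :=
  normc_psumB n (normc_signs (signs_sgn c)) l1.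
have E : pseries (fun k => sgn (c' k)) l n = pseries (fun k => sgn (c k)) l n.
  by rewrite /pseries /series /=; apply: eq_big_nat => k /andP[_ /cc' ->].
have := nP n (leqnn n); apply: le_lt_trans.
apply: (@le_trans _ _ (normc (u - v))).
  by rewrite ler_piMl ?normc_ge0// ltW.
have := normc_triangle u (pseries (fun k => sgn (c k)) l n) v.
move: h1 h2; rewrite E (normc_distC v) mul1r => h1 h2 /le_trans; apply.
by apply: le_trans (lerD h1 h2) _; rewrite le_eqVlt; apply/orP; left; apply/eqP; ring.
Qed.

(** Half the difference of two signs lies in {-1, 0, 1}: this links pairs of sign expansions to
    ternary ones, and serves both implications below. *)
Lemma psum_half_sub l (a a' d : nat -> R[i]) : normc l < 1 ->
  signs a -> signs a' -> (forall k, d k = (a k - a' k) / 2) ->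
  psum d l = (psum a l - psum a' l) / 2.
Proof.
move=> l1 sa sa' dE.
apply: (@psum_geometric _ _ _ _ (1 - normc l)^-1) => // n.
have -> : pseries d l n = (pseries a l n - pseries a' l n) / 2.
  elim: n => [|n IH]; first by rewrite !pseries0 subrr mul0r.
  by rewrite !pseriesS IH dE; ring.
have -> : (psum a l - psum a' l) / 2 - (pseries a l n - pseries a' l n) / 2 =
    2^-1 * ((psum a l - pseries a l n) - (psum a' l - pseries a' l n)) by ring.
rewrite normcM.
have -> : normc (2^-1 : R[i]) = 2^-1.
  have -> : (2 : R[i]) = (2 : R)%:C by rewrite rmorph_nat.
  by rewrite normcV normc_real ger0_norm.
have h := le_normcD (psum a l - pseries a l n) (- (psum a' l - pseries a' l n)).
rewrite normcN in h.
have := normc_psumB n (normc_signs sa) l1; have := normc_psumB n (normc_signs sa') l1.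
rewrite mul1r [_^-1 * _ ^+ _]mulrC.
by lra.
Qed.

(** * Connectedness of the attractor and zeros of ternary series *)

Definition ternary (b : nat -> R[i]) := forall k, [\/ b k = -1, b k = 0 | b k = 1].

Lemma normc_ternary b : ternary b -> forall k, normc (b k) <= 1.
Proof.
by move=> h k; case: (h k) => ->; rewrite ?normcN ?normc1 ?normc0.
Qed.

Lemma Mset_zero l : Mset R l ->
  normc l < 1 /\ exists b, [/\ b 0%N = 1, ternary b & psum b l = 0].
Proof.
move=> [l1 conn]; have {}l1 : normc l < 1 by move: l1; rewrite normrE ltcR.
split=> //.
pose A := attractor l; pose piece b := [set sgn b + l * z | z in A].
have pieceA b : piece b `<=` A by move=> _ [z Az <-]; exact: attractor_step.
have [z0 Az0] : A !=set0.
  by exists (psum (fun=> sgn true) l); apply/(attractorP _ l1); exists (fun=> true).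
have piece0 b : piece b (sgn b + l * z0) by exists z0.
have [z [z' [Az Az' zz']]] : exists z z', [/\ A z, A z' & 1 + l * z = -1 + l * z'].
  apply: contrapT => nmeet.
  have disj z : piece true z -> ~ piece false z.
    move=> [u Au <-] [v Av]; rewrite /sgn => uv.
    by apply: nmeet; exists u, v; split.
  (* If the halves were disjoint, [piece true] would be relatively clopen: it is closed, and it is
     the trace of the complement of the closed set [piece false]. *)
  have : piece true = A.
    apply: conn.
    - by exists (sgn true + l * z0).
    - exists (~` piece false); first exact/closed_openC/closed_piece.
      apply/seteqP; split=> [z pz|z [Az npz]].
        by split; [exact: pieceA pz|exact: disj].
      by have [[] [v Av zE]] := attractor_split l1 Az;
        [exists v|case: npz; exists v].
    - exists (piece true); first exact: closed_piece.
      by apply/seteqP; split=> [z pz|z [_ pz]];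
        [split; [exact: pieceA pz|exact: pz]|exact: pz].
  move=> pE; apply: (disj (sgn false + l * z0)); last exact: piece0.
  by rewrite pE; apply: pieceA; exact: piece0.
move: Az Az' => /(attractorP _ l1)[c zE] /(attractorP _ l1)[c' zE'].
(* With these coefficients the series at [l] is half the difference of the two expressions for the
   common point of the halves. *)
pose b k := if k is j.+1 then (sgn (c j) - sgn (c' j)) / 2 else 1.
have tb : ternary b.
  move=> [|k]; first by constructor 3.
  rewrite /b /sgn; case: (c k); case: (c' k).
  - by constructor 2; rewrite subrr mul0r.
  - by constructor 3; field.
  - by constructor 1; field.
  - by constructor 2; rewrite subrr mul0r.
exists b; split=> //.
rewrite (psum_shift (normc_ternary tb) l1).
rewrite (@psum_half_sub _ (fun k => sgn (c k)) (fun k => sgn (c' k)))//; try exact: signs_sgn.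
rewrite -zE -zE' /=.
have -> : 1 + l * ((z - z') / 2) = ((1 + l * z) - (-1 + l * z')) / 2 by field.
by rewrite zz' subrr mul0r.
Qed.

(* A relatively clopen set splitting the attractor splits one of its two halves,
   since these meet; iterating, it splits arbitrarily small pieces around a
   single point of the attractor. *)
Lemma zero_Mset l b : normc l < 1 -> b 0%N = 1 -> ternary b -> psum b l = 0 ->
  Mset R l.
Proof.
move=> l1 b0 tb bl; split; first by rewrite normrE ltcR.
pose A := attractor l.
have [zz [Az zzE]] : exists zz : bool -> R[i], (forall e, A (zz e)) /\
    sgn true + l * zz true = sgn false + l * zz false.
  (* The coefficients -1, 0, 1 become the pairs of signs (-1, 1), (1, 1), (1, -1), whose
     half-differences they are. *)
  pose c (e : bool) k := if e then b k.+1 != -1 else b k.+1 != 1.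
  exists (fun e => psum (fun k => sgn (c e k)) l); split.
    by move=> e; apply/(attractorP _ l1); exists (c e).
  have hE k : shift b k = (sgn (c true k) - sgn (c false k)) / 2.
    have n1 : (1 : R[i]) != -1 by rewrite -subr_eq0 opprK -mulr2n pnatr_eq0.
    have n0 : (0 : R[i]) != -1 by rewrite eq_sym oppr_eq0 oner_eq0.
    rewrite /shift /c; case: (tb k.+1) => ->; rewrite /sgn.
    - by rewrite eqxx eq_sym n1 /=; field.
    - by rewrite n0 eq_sym oner_eq0 subrr mul0r.
    - by rewrite n1 eqxx /=; field.
  move: bl; rewrite (psum_shift (normc_ternary tb) l1) b0.
  rewrite (psum_half_sub l1 (signs_sgn _) (signs_sgn _) hE) => h.
  by apply/eqP; rewrite -subr_eq0 /sgn; apply/eqP; rewrite -[RHS](mulr0 2) -h; field.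
pose split (P : set R[i]) := exists x y, [/\ A x, A y, P x & ~ P y].
pose pull (e : bool) (P : set R[i]) : set R[i] := fun z => P (sgn e + l * z).
(* If [P] split neither half, it would be constant on each, hence on the whole attractor, as the
   halves share a point. Keeping the implication under [exists] lets [choice] define [E] on all
   sets. *)
have splitS P : exists e, split P -> split (pull e P).
  apply: contrapT => /forallNP h.
  have h1 e : split P /\ ~ split (pull e P).
    by have := h e; move=> /not_implyP.
  have [[x [y [Ax Ay Px nPy]]] _] := h1 true.
  have const e u v : A u -> A v -> P (sgn e + l * u) -> P (sgn e + l * v).
    move=> Au Av Pu; apply: contrapT => nPv; case: (h1 e) => _; apply.
    by exists u, v; split.
  have [e1 [u1 Au1 xE]] := attractor_split l1 Ax.
  have [e2 [u2 Au2 yE]] := attractor_split l1 Ay.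
  rewrite xE in Px; rewrite yE in nPy; apply: nPy.
  have := const _ _ _ Au1 (Az e1) Px; move: (const e2 _ _ (Az e2) Au2).
  by case: e1 {xE Px}; case: e2 {yE} => //; rewrite zzE; auto.
have [E EP] := choice splitS.
move=> B [x0 Bx0] [C oC BC] [D cD BD].
apply: contrapT => nBA.
have [y0 Ay0 nBy0] : exists2 y, A y & ~ B y.
  apply: contrapT => h; apply: nBA; apply/seteqP; split=> [z|z Az'].
    by rewrite BC => -[].
  by apply: contrapT => nBz; apply: h; exists z.
have Ax0 : A x0 by move: Bx0; rewrite BC => -[].
pose P n := iter n (fun Q => pull (E Q) Q) B.
have splitP n : split (P n).
  elim: n => [|n IH]; first by exists x0, y0; split.
  exact: EP.
pose c n := E (P n); pose S := pseries (fun k => sgn (c k)) l.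
have PE n z : P n z = B (S n + l ^+ n * z).
  elim: n z => [|n IH] z; first by rewrite /S pseries0 add0r expr0 mul1r.
  have -> : P n.+1 z = P n (sgn (c n) + l * z) by [].
  rewrite IH; congr (B _).
  by rewrite /S pseriesS exprSr; ring.
(* The nested pieces [S n + l ^+ n * A], each split by [B], shrink to [x]. *)
pose x := psum (fun k => sgn (c k)) l.
have Ax : A x by apply/(attractorP _ l1); exists c.
have near_x (O : set R[i]) : nbhs x O ->
    exists n, forall v, A v -> O (S n + l ^+ n * v).
  move=> /nbhs_normcP[e e0 eO].
  have l01 : 0 <= normc l < 1 by rewrite normc_ge0.
  have [n nP] := geometric_small (2 / (1 - normc l)) l01 e0.
  exists n => v Av; apply: eO.
  have h1 : normc (x - S n) <= _ := normc_psumB n (normc_signs (signs_sgn c)) l1.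
  have h2 : normc (l ^+ n * v) <= normc l ^+ n * (1 - normc l)^-1.
    rewrite normcM normcX ler_wpM2l ?exprn_ge0 ?normc_ge0//.
    exact: normc_attractor.
  have := nP n (leqnn n); apply: le_lt_trans.
  rewrite addrAC; apply: le_trans (le_normcD _ _) _.
  rewrite normc_distC; apply: le_trans (lerD h1 h2) _.
  by rewrite le_eqVlt; apply/orP; left; apply/eqP; ring.
(* If [x] is in [B], relative openness puts a small piece inside [B]; otherwise relative closedness
   puts one outside. Either contradicts [splitP]. *)
have [Bx|nBx] := pselect (B x).
  have Cx : C x by move: Bx; rewrite BC => -[].
  have [n nP] := near_x C (open_nbhs_nbhs (conj oC Cx)).
  have [u [v [Au Av Pu nPv]]] := splitP n.
  apply: nPv; rewrite PE BC; split; last exact: nP.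
  exact: attractor_prefix.
have nDx : (~` D) x by move=> Dx; apply: nBx; rewrite BD; split.
have [n nP] := near_x (~` D) (open_nbhs_nbhs (conj (closed_openC cD) nDx)).
have [u [v [Au Av Pu nPv]]] := splitP n.
apply: (nP u Au); move: Pu; rewrite PE BD => -[_].
exact.
Qed.

End Attractor.

(** * Ternary expansions in a parallelogram for [l] in [Hset] *)

Section Covering.
Context {R : realType}.
Implicit Types (l z w : R[i]).

(** The last inequality is |l - 1/3| >= 2/3, squared and expanded. *)
Lemma HsetE l : Hset R l ->
  [/\ 0 < complex.Re l, 0 < complex.Im l, normc l ^+ 2 < 1 / 2 &
      1 + 2 * complex.Re l <= 3 * normc l ^+ 2].
Proof.
move=> [[]]; rewrite normrE ltcR => l2 [x0 y0] /= nl; split=> //.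
  have s2 : 0 < Num.sqrt (2 : R) by rewrite sqrtr_gt0.
  have : normc l ^+ 2 < ((Num.sqrt 2)^-1) ^+ 2.
    by rewrite ltrXn2r// ?nnegrE ?normc_ge0// invr_ge0 ltW.
  by rewrite exprVn sqr_sqrtr// div1r.
have : (2 / 3) ^+ 2 <= normc (l - (3^-1)%:C) ^+ 2.
  rewrite lerXn2r ?nnegrE ?normc_ge0//.
  by rewrite leNgt; apply/negP => h; apply: nl; rewrite normrE ltcR.
rewrite !normc_sqr; case: l {l2 x0 y0 nl} => x y /=; lra.
Qed.

Lemma Hset_bounds l : Hset R l ->
  [/\ normc l < 1, complex.Re l < 1 / 4 & 1 / 2 < complex.Im l].
Proof.
move=> /HsetE[x0 y0 l2 h].
have x4 : complex.Re l < 1 / 4 by lra.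
split=> //.
  by rewrite ltNge; apply/negP => l1; have := ler_pM ler01 ler01 l1 l1; rewrite -expr2; lra.
rewrite normc_sqr in h; rewrite ltNge; apply/negP => y2.
have : complex.Im l ^+ 2 <= (1 / 2) ^+ 2 by rewrite lerXn2r ?nnegrE; lra.
have : complex.Re l ^+ 2 <= (1 / 4) * complex.Re l.
  by rewrite expr2 ler_wpM2r; lra.
by lra.
Qed.

(** Subtracting a digit reduces a first coordinate in [-3/2, 3/2] to [-1/2, 1/2]; division by |l|^2
    then gives the bound 1 / (2 |l|^2) on the second one. *)
Definition box l : set R[i] := [set z | exists u v : R,
  [/\ z = u%:C + v%:C * l, `|u| <= 3 / 2 & `|v| * (2 * normc l ^+ 2) <= 1]].

Lemma quadratic_relation l :
  l ^+ 2 = (2 * complex.Re l)%:C * l - (normc l ^+ 2)%:C.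
Proof.
case: l => x y; rewrite normc_sqr /=; apply/eqP; rewrite eq_complex /= expr2 /=.
by apply/andP; split; apply/eqP; ring.
Qed.

(* In the basis [1, l] multiplication by [l] sends (u, v) to
   (- |l|^2 v, u + 2 (Re l) v); the digit rounds the first coordinate, and the
   condition 1 + 2 Re l <= 3 |l|^2 defining [Hset] says that the second fits. *)
Lemma box_cover l z : Hset R l -> box l z ->
  exists b z', [/\ [\/ b = -1, b = 0 | b = 1], box l z' & z = b + l * z'].
Proof.
move=> Hl [s [t [zE sb tb]]]; have [x0 y0 l2 h] := HsetE Hl.
have lpos : 0 < normc l ^+ 2 by lra.
have [b [bE bs]] : exists b : R, [\/ b = -1, b = 0 | b = 1] /\ `|b - s| <= 1 / 2.
  move: sb; rewrite ler_norml => /andP[s1 s2].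
  have [sm|sm] := ltrP s (- (1 / 2)).
    by exists (-1); split; [constructor 1|rewrite ler_norml; lra].
  have [sp|sp] := ltrP (1 / 2) s.
    by exists 1; split; [constructor 3|rewrite ler_norml; lra].
  by exists 0; split; [constructor 2|rewrite ler_norml; lra].
(* Comparing coordinates in z = b + l (u + v l) gives s = b - v |l|^2 and t = u + 2 Re(l) v, solved
   for [v] and then [u]. *)
pose v := (b - s) / normc l ^+ 2.
have vE : v * normc l ^+ 2 = b - s by rewrite /v divfK// gt_eqF.
have vb : `|v| * (2 * normc l ^+ 2) <= 1.
  by rewrite mulrCA -(ger0_norm (ltW lpos)) -normrM vE; lra.
pose u := t - 2 * complex.Re l * v.
exists b%:C, (u%:C + v%:C * l); split.
- case: bE => ->; [constructor 1|constructor 2|constructor 3] => //.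
  by rewrite rmorphN1.
- exists u, v; split=> //.
  have : `|u| <= `|t| + 2 * complex.Re l * `|v|.
    apply: le_trans (ler_normB _ _) _.
    by rewrite normrM [`|2 * _|]ger0_norm// mulr_ge0// ltW.
  move=> /le_trans; apply; rewrite -(ler_pM2r lpos).
  have : 2 * complex.Re l * (`|v| * (2 * normc l ^+ 2)) <= 2 * complex.Re l * 1.
    by rewrite ler_wpM2l//; lra.
  by lra.
- have sE : s = b - v * normc l ^+ 2 by rewrite vE; ring.
  have tE : t = u + 2 * complex.Re l * v by rewrite /u; ring.
  have -> : l * (u%:C + v%:C * l) = l * u%:C + v%:C * l ^+ 2 by ring.
  rewrite zE sE tE quadratic_relation rmorphB !(rmorphD, rmorphM).
  by ring.
Qed.

Lemma box_bounded l z : Hset R l -> box l z -> normc z <= 4.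
Proof.
move=> Hl [u [v [-> ub vb]]]; have [x0 y0 l2 h] := HsetE Hl.
have [l1 _ _] := Hset_bounds Hl.
apply: le_trans (le_normcD _ _) _; rewrite normcM !normc_real.
have : `|v| <= 3 / 2.
  rewrite leNgt; apply/negP => v2.
  have : 3 / 2 * (2 * normc l ^+ 2) < `|v| * (2 * normc l ^+ 2).
    by rewrite ltr_pM2r//; lra.
  by lra.
have : `|v| * normc l <= `|v| * 1 by rewrite ler_wpM2l// ltW.
by lra.
Qed.

(** Since Im l > 1/2, the second coordinate Im w / Im l is at most 1 in modulus, which fits because
    |l|^2 < 1/2. The radius 1/2 is uniform in [l], so [l] may vary afterwards. *)
Lemma box_nbhs0 l w : Hset R l -> normc w <= 1 / 2 -> box l w.
Proof.
move=> Hl w2; have [x0 y0 l2 h] := HsetE Hl.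
have [l1 x4 y2] := Hset_bounds Hl.
have hr := ler_Re_normc w; have hi := ler_Im_normc w.
pose v := complex.Im w / complex.Im l.
have vE : v * complex.Im l = complex.Im w by rewrite /v divfK// gt_eqF.
have v1 : `|v| <= 1.
  rewrite /v normrM normfV (gtr0_norm y0) ler_pdivrMr// mul1r; lra.
clearbody v; exists (complex.Re w - v * complex.Re l), v; split.
- apply/eqP; rewrite eq_complex; move: vE; clear.
  case: l => x y; case: w => p q /= vE; apply/andP; split; apply/eqP; lra.
- apply: le_trans (ler_normB _ _) _; rewrite normrM (gtr0_norm x0).
  have : `|v| * complex.Re l <= 1 * complex.Re l by rewrite ler_wpM2r// ltW.
  by lra.
- have : `|v| * (2 * normc l ^+ 2) <= 1 * (2 * normc l ^+ 2).
    by rewrite ler_wpM2r// mulr_ge0// exprn_ge0// normc_ge0.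
  by lra.
Qed.

(** Iterating [box_cover] produces the digits; the remainder after [n] of them is [l ^+ n] times a
    point of the bounded box. *)
Lemma box_expansion l z : Hset R l -> box l z ->
  exists2 b, ternary b & psum b l = z.
Proof.
move=> Hl Bz; have [l1 _ _] := Hset_bounds Hl.
have step (w : R[i]) : exists p : R[i] * R[i], box l w ->
    [/\ [\/ p.1 = -1, p.1 = 0 | p.1 = 1], box l p.2 & w = p.1 + l * p.2].
  (* The pair (0, 0) is a default outside the box; the orbit of [z] never leaves the box. *)
  have [Bw|nBw] := pselect (box l w); last by exists (0, 0).
  by have [b [w' h]] := box_cover Hl Bw; exists (b, w').
have [F FP] := choice step.
pose zs n := iter n (fun w => (F w).2) z.
have Bzs n : box l (zs n) by elim: n => [//|n /FP[]].
pose b n := (F (zs n)).1.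
exists b; first by move=> n; have [] := FP _ (Bzs n).
apply: (@psum_geometric _ _ _ _ 4) => // n.
have -> : z = pseries b l n + l ^+ n * zs n.
  elim: n => [|n IH]; first by rewrite pseries0 expr0 mul1r add0r.
  rewrite {1}IH; have [_ _ {1}->] := FP _ (Bzs n).
  by rewrite pseriesS exprSr -/(b n) /=; ring.
rewrite addrC addKr normcM normcX mulrC.
by rewrite ler_wpM2r ?exprn_ge0 ?normc_ge0//; exact: (box_bounded Hl (Bzs n)).
Qed.

Lemma psum_split a l (K : R) n : (forall k, normc (a k) <= K) -> normc l < 1 ->
  psum a l = pseries a l n + l ^+ n * psum (shiftn n a) l.
Proof.
move=> aK l1; elim: n => [|n ->]; first by rewrite pseries0 add0r expr0 mul1r.
by rewrite pseriesS (psum_shiftn n aK l1) exprSr; ring.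
Qed.

Lemma Hset_trunc_Mset b n l : ternary b -> b 0%N = 1 -> (0 < n)%N -> Hset R l ->
  normc (trunc b n).[l] <= normc l ^+ n / 2 -> Mset R l.
Proof.
move=> tb b0 n0 Hl; have [l1 _ _] := Hset_bounds Hl.
have [x0 y0 l2 h] := HsetE Hl.
have lpos : 0 < normc l by rewrite lt0r normc_ge0 andbT; apply: contraTneq h => ->; rewrite expr0n /=; lra.
rewrite horner_trunc => bn.
have ln0 : l ^+ n != 0 by rewrite expf_neq0// -normc_gt0.
have [|d td dE] := @box_expansion l (- pseries b l n / l ^+ n) Hl.
  apply: box_nbhs0 => //; rewrite normcM normcN normcV normcX.
  by rewrite ler_pdivrMr ?exprn_gt0//; lra.
(* The first [n] coefficients of [b] are kept and followed by the digits of the missing tail;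
   [0 < n] preserves the constant term 1. *)
pose c k := if (k < n)%N then b k else d (k - n)%N.
have tc : ternary c by move=> k; rewrite /c; case: ifP.
apply: (@zero_Mset _ _ c) => //; first by rewrite /c n0.
rewrite (psum_split n (normc_ternary tc) l1).
have -> : shiftn n c = d.
  by apply/funext => k; rewrite /shiftn /c ltnNge leq_addr /= addKn.
have -> : pseries c l n = pseries b l n.
  by rewrite /pseries /series /=; apply: eq_big_nat => k /andP[_ kn]; rewrite /c kn.
by rewrite dE; field.
Qed.

End Covering.

(** * Zeros of partial sums as interior points *)

Theorem mainTheorem1 (R : realType) :
  Mset R `&` (Hset R)° `<=` closure (Mset R)°.
Proof.
move=> l0 [/Mset_zero[l1 [b [b0 tb bl]]] Hl0] B.
move: Hl0 => /nbhs_normcP[e1 e10 e1H] /nbhs_normcP[e2 e20 e2B].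
have e0 : 0 < Num.min e1 e2 by rewrite lt_min e10.
have b00 : b 0%N != 0 by rewrite b0 oner_eq0.
have [n [z [n0 zl0 pz]]] := trunc_zero (normc_ternary tb) l1 b00 bl e0.
move: zl0; rewrite lt_min => /andP[ze1 ze2].
exists z; split; last exact: e2B.
have Hz := e1H z ze1; have [_ y0 _ _] := HsetE Hz.
have zpos : 0 < normc z by have := ler_Im_normc z; rewrite gtr0_norm//; lra.
(* Errors below |z|^n / 4 in both the partial sum and the power give |l|^n > (3/4) |z|^n, so the
   partial sum at [l] is at most |l|^n / 2. *)
have zn0 : 0 < normc z ^+ n / 4 by rewrite divr_gt0// exprn_gt0.
have [d1 d10 d1P] := horner_continuous (trunc b n) z zn0.
have [d2 d20 d2P] := horner_continuous 'X^n z zn0.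
apply/nbhs_normcP; exists (Num.min (e1 - normc (z - l0)) (Num.min d1 d2)).
  by rewrite !lt_min d10 d20 !andbT; lra.
move=> l; rewrite !lt_min => /andP[le1 /andP[/d1P ld1 /d2P ld2]].
apply: (Hset_trunc_Mset tb b0 n0).
  by apply: e1H; have := normc_triangle l z l0; lra.
move: ld1 ld2; rewrite pz subr0 !hornerXn => ld1 ld2.
have := ler_normcB (z ^+ n) (l ^+ n); rewrite normc_distC !normcX.
by lra.
Qed.
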